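(* Let $(X_1,|\cdot|_1)$ and $(X_2,|\cdot|_2)$ be Banach spaces, let $K_1\subset X_1$ be a non-degenerate cone, and let $B_R\subset X_2$ be the closed ball centered at the origin of radius $R>0$. Let $T_1\colon K_1\times X_2\to K_1$ and $T_2\colon K_1\times B_R\to X_2$ be completely continuous operators, and let $\mathcal{F}\colon K_1\times K_1\to\mathbb{R}$ be a continuous functional such that for any $u\in K_1\setminus\{0\}$ and $\lambda>0$ one has $\mathcal{F}(\lambda u,u)=0$ if and only if $\lambda=1$. Assume that: (a1) the set $T_2(K_1\times B_R)$ is bounded in $X_2$; (a2) for every $(u,v)\in (K_1\setminus\{0\})\times B_R$ there exists a unique number $s(u,v)>0$ such that $\mathcal{F}\bigl(T_1(s(u,v)u,v),\,s(u,v)u\bigr)=0$; (a3) there exist $0<m<M<\infty$ such that $\inf_{S^1_{K_1}\times B_R}s(\cdot,\cdot)>m$ and $\sup_{S^1_{K_1}\times B_R}s(\cdot,\cdot)<M$, where $S^1_{K_1}:=\{u\in K_1:|u|_1=1\}$. In addition, assume that $v\neq\lambda T_2(u,v)$ for all $u\in K_1$, $v\in\partial B_R$ and $\lambda\in(0,1)$. Then the operator $(T_1,T_2)$ has a fixed point in $K_1\times B_R$, i.e. there is $(u,v)\in K_1\times B_R$ with $T_1(u,v)=u$ and $T_2(u,v)=v$.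
   Context: A non-degenerate cone in a Banach space is a closed, convex set $K_1$ with $\lambda K_1\subset K_1$ for all $\lambda\in\mathbb{R}_+=[0,\infty)$ and $K_1\setminus\{0\}\neq\emptyset$. An operator is completely continuous if it is continuous and maps bounded sets into relatively compact sets. $\partial B_R=\{v\in X_2:|v|_2=R\}$. *)

(* Defs.v *)
From HB Require Import structures.
From mathcomp Require Import all_boot all_order all_algebra.
From mathcomp Require Import all_classical all_reals all_analysis.

Set Implicit Arguments.
Unset Strict Implicit.
Unset Printing Implicit Defensive.

Import Order.TTheory GRing.Theory Num.Theory.
Import numFieldNormedType.Exports.

Local Open Scope classical_set_scope.
Local Open Scope ring_scope.

(* The cone need not be pointed: K `&` -K = {0} is not required. *)
Definition nondegenerate_cone (R : realType) (X : normedModType R)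
    (K : set X) : Prop :=
  [/\ closed K,
      convex_set K,
      forall (l : R) (x : X), 0 <= l -> K x -> K (l *: x)
    & K `\ 0 !=set0].

(* An operator D -> E, with D a subset of X and E a subset of Y, is a function
   X -> Y whose values outside D are irrelevant. When E is closed in Y,
   relative compactness in E and in Y coincide. *)
Definition completely_continuous (R : realType) (X Y : normedModType R)
    (D : set X) (T : X -> Y) : Prop :=
  {within D, continuous T} /\
  forall A : set X, A `<=` D -> bounded_set A -> precompact (T @` A).

Definition unit_sphere_in (R : realType) (X : normedModType R)
    (K : set X) : set X := [set u | K u /\ `|u| = 1].

(* Main.v *)
Require Import Defs.
From HB Require Import structures.
From mathcomp Require Import all_boot all_order all_algebra.
From mathcomp Require Import zify ring lra.

(** Scaling by [s] retracts the cone onto the region below the surface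
    [{s(u,v) u}]: put [rho(u,v) = min(1, s(u,v)) u]. With [pi] the radial
    projection onto the ball, [G(u,v) = (T1(rho(u,v), v), pi(T2(rho(u,v), v)))]
    is a compact self-map of the closed convex set [K1 x B_R], so it has a fixed
    point by Schauder's theorem. The Leray-Schauder condition makes [pi]
    inactive there. If [s = s(u,v) < 1], then [T1(s u, v) = u] is the multiple
    [1/s] of [s u], and [F(T1(s u, v), s u) = 0] forces [1/s = 1], a
    contradiction; hence [rho(u,v) = u] and the fixed point of [G] is one of
    [(T1, T2)].

    Schauder's theorem is reduced to Brouwer's on the simplex by Schauder
    projections, and Brouwer's theorem follows from Scarf's lemma on families of
    linear orders, applied to the coordinate orders on the points of a fine
    grid, a point [x] being coloured by some [i] with [x_i <= f(x)_i]. *)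

Set Implicit Arguments.
Unset Strict Implicit.
Unset Printing Implicit Defensive.

(** * Scarf's lemma *)

(** The count is 1, 2 or 0. If [S] is rainbow, [c] is injective on it and only the point coloured
    [i0] can be removed. Otherwise, once removing some [x] leaves all colours but [i0], the colour
    of [x] is repeated at exactly one [x'], and [x], [x'] are the two removable points. *)
Lemma odd_card_rainbow_facets (V I : finType) (c : V -> I) (i0 : I)
    (S : {set V}) : #|S| = #|I| ->
  odd #|[set x in S | c @: (S :\ x) == [set~ i0]]| = (c @: S == setT).
Proof.
move=> cardS.
have inj_facet x : x \in S -> c @: (S :\ x) = [set~ i0] ->
    {in S :\ x &, injective c}.
  move=> xS fx; apply/imset_injP; rewrite fx cardsC1.
  by have := cardsD1 x S; rewrite xS cardS add1n => ->.
case: eqP => [full|notfull].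
  have injc : {in S &, injective c}.
    by apply/imset_injP; rewrite full cardsT cardS.
  have : i0 \in c @: S by rewrite full.
  case/imsetP => x0 x0S i0E.
  suff -> : [set x in S | c @: (S :\ x) == [set~ i0]] = [set x0].
    by rewrite cards1.
  apply/setP => x; rewrite !inE; apply/andP/eqP => [[xS /eqP fx]|->].
    apply/eqP/negPn/negP => x_neq.
    have : i0 \in c @: (S :\ x).
      by apply/imsetP; exists x0 => //; rewrite !inE x0S eq_sym x_neq.
    by rewrite fx !inE eqxx.
  split=> //; apply/eqP/setP => i; rewrite !inE; apply/imsetP/idP.
    case=> y /[!inE] /andP[y_neq yS] ->; apply: contraNneq y_neq => cy.
    by apply/eqP; apply: injc => //; rewrite cy.
  move=> i_neq; have : i \in c @: S by rewrite full.
  case/imsetP => y yS iE; exists y => //; rewrite !inE yS andbT.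
  by apply: contraNneq i_neq => yx; rewrite iE yx i0E.
case: (set_0Vmem [set x in S | c @: (S :\ x) == [set~ i0]]) => [->|[x]].
  by rewrite cards0.
rewrite inE => /andP[xS /eqP fx].
have cx : c x != i0.
  apply/eqP => cx; apply: notfull; apply/setP => i; rewrite inE.
  have [->|i_neq] := eqVneq i i0; first by rewrite -cx imset_f.
  have : i \in c @: (S :\ x) by rewrite fx !inE.
  by apply: (subsetP (imsetS _ (subsetDl _ _))).
have : c x \in c @: (S :\ x) by rewrite fx !inE.
case/imsetP => x' x'S cxE.
move: (x'S); rewrite !inE => /andP[x'x x'S'].
suff -> : [set z in S | c @: (S :\ z) == [set~ i0]] = [set x; x'].
  by rewrite cards2 eq_sym x'x.
apply/setP => z; rewrite !inE; apply/andP/orP => [[zS /eqP fz]|].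
  case: eqVneq => [|zx]; first by left.
  case: eqVneq => [|zx']; first by right.
  have inj := inj_facet x xS fx.
  have : c z \in c @: (S :\ z).
    rewrite fz -fx; apply: imset_f; by rewrite !inE zx zS.
  case/imsetP => y /[!inE] /andP[yz yS] czE.
  have [yx|yx] := eqVneq y x.
    suff: z = x' by move=> /eqP; rewrite (negPf zx').
    by apply: inj; rewrite ?inE ?zx ?zS ?x'x // czE yx.
  suff: z = y by move=> /eqP; rewrite eq_sym (negPf yz).
  by apply: inj; rewrite ?inE ?zx ?zS ?yx.
case=> /eqP ->; first by rewrite xS fx.
rewrite x'S' -fx; split=> //; apply/eqP/setP => i.
apply/imsetP/imsetP => -[y /[!inE] /andP[yn yS] ->].
  have [->|yx] := eqVneq y x; first by exists x'; rewrite ?inE ?x'x.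
  by exists y; rewrite // !inE yx.
have [->|yx] := eqVneq y x'; first by exists x; rewrite ?inE ?xS 1?eq_sym ?x'x.
by exists y; rewrite // !inE yx.
Qed.

Section Scarf.
Variables (V I : finType) (rk : I -> V -> nat).
Hypothesis rk_inj : forall i, injective (rk i).

(** For nonempty [S]: no point lies strictly above the minimum of [S] in all orders at once.
    Dominant sets take the place of the simplices of a triangulation. *)
Definition dominant (S : {set V}) :=
  [forall y, exists i, [forall x in S, rk i y <= rk i x]].

Lemma dominantP (S : {set V}) :
  reflect (forall y, exists i, {in S, forall x, rk i y <= rk i x}) (dominant S).
Proof.
apply: (iffP forallP) => H y; have := H y.
  by case/existsP => i /forall_inP; exists i.
by case=> i Hi; apply/existsP; exists i; apply/forall_inP.
Qed.

Lemma sub_dominant (S S' : {set V}) :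
  S' \subset S -> dominant S -> dominant S'.
Proof.
move=> /subsetP sub /dominantP dS; apply/dominantP => y.
by have [i Hi] := dS y; exists i => x /sub; apply: Hi.
Qed.

Lemma lt_rk i x y : x != y -> rk i x <= rk i y -> rk i x < rk i y.
Proof.
by move=> xy; rewrite leq_eqVlt => /orP[/eqP/rk_inj/eqP|//]; rewrite (negPf xy).
Qed.

(* A facet D meets |I| order minima with only |I| - 1 elements, so exactly two
   orders a, b share their minimum in D; D extends to a dominant set by the
   a-largest point of the region where all the other orders exceed their
   minima on D, and likewise for b. *)
Lemma card_dominant_extensions (D : {set V}) (z : V) (e : I -> V) :
    dominant D -> #|D|.+1 = #|I| -> z \in D ->
    (forall i j, i != j -> rk i z < rk i (e j)) ->
  #|[set x | x \notin D & dominant (x |: D)]| = 2.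
Proof.
move=> domD cardD zD zlt.
pose mu i := [arg min_(x < z in D) rk i x].
have muD i : mu i \in D by rewrite /mu; case: arg_minnP.
have mu_min i x : x \in D -> rk i (mu i) <= rk i x.
  by rewrite /mu; case: arg_minnP => // y yD H; apply: H.
have muP i x : x \in D -> {in D, forall y, rk i x <= rk i y} -> mu i = x.
  move=> xD H; apply: (@rk_inj i); apply/eqP.
  by rewrite eqn_leq mu_min //= H.
have mu_onto x : x \in D -> exists i, mu i = x.
  by move=> xD; have [i Hi] := dominantP _ domD x; exists i; apply: muP.
pose M j := [set y | [forall i, (i != j) ==> (rk i (mu i) < rk i y)]].
have MP j y : reflect (forall i, i != j -> rk i (mu i) < rk i y) (y \in M j).
  by rewrite inE; apply: (iffP forall_inP).
(* By counting, [onto j] makes [mu] injective off [j]. It therefore singles out the two orders [a],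
   [b] sharing a minimum: dropping any other order keeps the collision. *)
pose onto j := mu @: [set~ j] == D.
have ontoP j : onto j -> {in [set~ j] &, injective mu}.
  move=> /eqP ontoj; apply/imset_injP.
  by rewrite ontoj cardsC1 -cardD.
have onto_sub j : (forall x, x \in D -> exists2 i, i != j & mu i = x) -> onto j.
  move=> H; rewrite /onto eqEsubset; apply/andP; split.
    by apply/subsetP => _ /imsetP[i _ ->]; apply: muD.
  apply/subsetP => x /H[i ij <-]; apply: imset_f; by rewrite !inE.
have [a [b [ab mab]]] : exists a b, a != b /\ mu a = mu b.
  have : ~~ injectiveb mu.
    apply/negP => /injectiveP inj.
    have : #|mu @: [set: I]| <= #|D|.
      by apply: subset_leq_card; apply/subsetP => _ /imsetP[i _ ->].
    by rewrite card_imset // cardsT -cardD ltnn.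
  by move=> /injectivePn[a [b ab mab]]; exists a, b.
have onto_ab j : onto j = (j == a) || (j == b).
  apply/idP/orP => [oj|].
    case: eqVneq => [|ja]; [by left|]; case: eqVneq => [|jb]; first by right.
    have := ontoP j oj a b; rewrite !inE [a == j]eq_sym [b == j]eq_sym ja jb.
    by move=> /(_ isT isT mab)/eqP; rewrite (negPf ab).
  case=> /eqP ->; apply: onto_sub => x /mu_onto[i <-].
    have [->|] := eqVneq i a; last by exists i.
    by exists b; rewrite 1?eq_sym ?mab.
  have [->|] := eqVneq i b; last by exists i.
  by exists a.
pose top j := [set x in M j | [forall y in M j, rk j y <= rk j x]].
have top1 j : #|top j| = 1.
  (* The region is nonempty because [e j] lies above [z], hence above the minimum of [D], in every
     order but [j]. *)
  have eM : e j \in M j.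
    apply/MP => i ij; apply: leq_ltn_trans (mu_min i _ zD) _.
    exact: zlt.
  apply/eqP/cards1P; exists [arg max_(x > e j in M j) rk j x].
  case: arg_maxnP => // x xM xmax.
  apply/setP => y; rewrite !(in_set1, in_set _ y).
  apply/andP/eqP => [[yM /forall_inP ymax]|->].
    apply: (@rk_inj j); apply/eqP.
    by rewrite eqn_leq ymax // andbT; apply: xmax; rewrite inE.
  split; first by move: xM; rewrite inE.
  by apply/forall_inP => y' /xmax.
have extE : [set x | x \notin D & dominant (x |: D)] = top a :|: top b.
  apply/setP => x; rewrite [LHS]in_set in_setU.
  apply/andP/orP => [[xD /dominantP dx]|].
    (* In the order [j] the new point [x] is the minimum of [x |: D]. Each point of [D] must then be
       the minimum in some order other than [j], which is [onto j]. *)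
    have [j Hj] := dx x.
    have oj : onto j.
      apply: onto_sub => y yD; have [k Hk] := dx y.
      exists k; last first.
        by apply: muP => // y' y'D; apply: Hk; rewrite inE y'D orbT.
      apply: contraNneq xD => kj; suff -> : x = y by [].
      apply: (@rk_inj j); apply/eqP; rewrite eqn_leq Hj ?inE ?yD ?orbT //=.
      by rewrite -kj Hk // !inE eqxx.
    have xM : x \in M j.
      apply/MP => k kj; have [k' Hk'] := dx (mu k).
      have muk' : mu k' = mu k.
        by apply: muP => // y' y'D; apply: Hk'; rewrite inE y'D orbT.
      have k'j : k' != j.
        apply: contraNneq xD => k'j; suff -> : x = mu k by [].
        apply: (@rk_inj j); apply/eqP; rewrite eqn_leq Hj ?inE ?muD ?orbT //=.
        by rewrite -k'j Hk' // !inE eqxx.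
      have k'k : k' = k by apply: (ontoP j oj); rewrite ?inE.
      apply: lt_rk; last by rewrite k'k in Hk'; apply: Hk'; rewrite !inE eqxx.
      by apply: contraNneq xD => <-.
    have : x \in top j.
      rewrite inE xM; apply/forall_inP => y /MP yM; have [i Hi] := dx y.
      have [->|ij] := eqVneq j i; first by apply: Hi; rewrite !inE eqxx.
      have := yM i; rewrite eq_sym ij => /(_ isT).
      by rewrite ltnNge Hi // inE muD orbT.
    by move: oj; rewrite onto_ab => /orP[] /eqP ->; [left|right].
  have topP j : onto j -> x \in top j -> x \notin D /\ dominant (x |: D).
    move=> oj; rewrite in_set => /andP[/MP xM /forall_inP xmax]; split.
      apply/negP => xD; move: (xD); rewrite -(eqP oj) => /imsetP[i].
      by rewrite !inE => /xM /[swap] <-; rewrite ltnn.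
    apply/dominantP => y; case: (boolP (y \in M j)) => yM.
      have [i Hi] := dominantP _ domD y; exists i => x'.
      have ij : i = j.
        apply/eqP; apply/negPn/negP => /(MP _ _ yM i).
        by rewrite ltnNge Hi.
      rewrite !inE => /orP[/eqP ->|/Hi //]; rewrite ij.
      exact: xmax.
    move: yM; rewrite inE negb_forall => /existsP[i].
    rewrite negb_imply -leqNgt => /andP[ij yi]; exists i => x'.
    rewrite !inE => /orP[/eqP ->|x'D]; apply: leq_trans yi _.
      exact/ltnW/xM.
    exact: mu_min.
  by case=> /topP; apply; rewrite onto_ab eqxx ?orbT.
rewrite extE cardsU !top1.
(* A point of both regions would exceed the minimum of [D] in every order, as [a] and [b] differ,
   against the dominance of [D]. *)
suff -> : top a :&: top b = set0 by rewrite cards0.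
apply/setP => x; rewrite in_setI [RHS]in_set0.
apply/negP => /andP[]; rewrite ![x \in top _]in_set.
move=> /andP[/MP xa _] /andP[/MP xb _].
have [i Hi] := dominantP _ domD x.
have [ia|/xa] := eqVneq i a; last by rewrite ltnNge Hi.
by have := xb i; rewrite ia => /(_ ab); rewrite ltnNge -ia Hi.
Qed.

Variable e : I -> V.
Hypothesis e_min : forall i y, rk i (e i) <= rk i y.
Hypothesis e_max : forall i j y, i != j -> y \notin codom e ->
  rk i y < rk i (e j).
Hypothesis non_slack : exists y, y \notin codom e.
Variable c : V -> I.
Hypothesis c_e : forall i, c (e i) = i.

Let e_inj : injective e. Proof. exact: can_inj c_e. Qed.

(** This facet lies on the boundary, so it extends on one side only. Adding [e i0] fails, since a
    non-slack point beats every [e i] in the order [i]. A non-slack point works exactly when it is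
    the [i0]-largest of its kind. *)
Lemma card_outer_extension i0 :
  #|[set x | x \notin e @: [set~ i0] & dominant (x |: e @: [set~ i0])]| = 1.
Proof.
have [y0 y0r] := non_slack; set D := e @: _.
have DP x : x \in D -> exists2 j, j != i0 & x = e j.
  by case/imsetP => j; rewrite !inE; exists j.
have eD j : j != i0 -> e j \in D by move=> ji; apply: imset_f; rewrite !inE.
apply/eqP/cards1P.
exists [arg max_(x > y0 | x \notin codom e) rk i0 x].
case: arg_maxnP => // x xr xmax.
have not_le i y : y \notin codom e -> ~ (rk i y <= rk i (e i)).
  move=> yr le; have yE : y = e i.
    by apply: (@rk_inj i); apply/eqP; rewrite eqn_leq le e_min.
  by move: yr; rewrite yE codom_f.
apply/setP => y; rewrite in_set1 in_set.
apply/andP/eqP => [[yD /dominantP dy]|->].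
  have yr : y \notin codom e.
    apply/negP => /codomP[j yE].
    have ji : j = i0 by apply/eqP; apply: contraNT yD => /eD; rewrite yE.
    have [i Hi] := dy y0; apply: (@not_le i y0 y0r); apply: Hi.
    rewrite inE; have [->|/eD ->] := eqVneq i i0; last by rewrite orbT.
    by rewrite inE yE ji eqxx.
  apply: (@rk_inj i0); apply/eqP; rewrite eqn_leq [_ <= _](xmax y yr) /=.
  have [i Hi] := dy x.
  have [<-|/eD eiD] := eqVneq i i0; first by apply: Hi; rewrite !inE eqxx.
  by case: (@not_le i x xr); apply: Hi; rewrite inE eiD orbT.
split; first by apply: contra xr => /DP[j _ ->]; rewrite codom_f.
apply/dominantP => y'; case: (boolP (y' \in codom e)) => [/codomP[j ->]|y'r].
  by exists j => z _; apply: e_min.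
exists i0 => z; rewrite !inE => /orP[/eqP ->|/DP[j ji ->]].
  by apply: xmax.
by rewrite ltnW // e_max // eq_sym.
Qed.

(** Parity of the incidences between rooms (dominant sets of [#|I|] points) and doors (facets with
    all colours but [i0]). Counted by rooms, it is the parity of the number of rainbow rooms.
    Counted by doors, the outer door contributes 1 and every other door 0 or 2, so a rainbow room
    exists. *)
Theorem Scarf_lemma : exists2 S, dominant S & c @: S = setT.
Proof.
have [i0 _] : exists i0 : I, True by have [y0 _] := non_slack; exists (c y0).
pose room S := dominant S && (#|S| == #|I|).
pose door (D : {set V}) := c @: D == [set~ i0].
(* Double counting: a pair of [S] and [x] in [S] corresponds to the pair of [D = S :\ x] and [x]
   outside [D]. *)
have sumE : \sum_(S | room S) #|[set x in S | door (S :\ x)]| =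
    \sum_(D : {set V} | door D && (#|D|.+1 == #|I|))
      #|[set x | x \notin D & dominant (x |: D)]|.
  under eq_bigr do rewrite -sum1_card; under [RHS]eq_bigr do rewrite -sum1_card.
  rewrite (exchange_big_dep xpredT) //= [RHS](exchange_big_dep xpredT) //=.
  apply: eq_bigr => x _.
  rewrite (reindex_onto (fun D => x |: D) (fun S => S :\ x)) /=; last first.
    by move=> S /andP[_]; rewrite inE => /andP[xS _]; rewrite setD1K.
  apply: eq_bigl => D; rewrite !inE eqxx /= /room.
  case: (boolP (x \in D)) => xD /=.
    rewrite andbF; apply/negbTE/negP => /andP[_ /eqP DE].
    by move: xD; rewrite -DE !inE eqxx.
  rewrite setU1K // eqxx andbT cardsU1 xD add1n /=.
  by rewrite andbC -!andbA; congr (_ && _); rewrite andbC.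
have odd_lhs : odd (\sum_(S | room S) #|[set x in S | door (S :\ x)]|) =
    odd #|[set S | room S && (c @: S == setT)]|.
  have -> : #|[set S | room S && (c @: S == setT)]| =
      \sum_(S | room S) (c @: S == setT).
    rewrite -sum1_card big_mkcond [RHS]big_mkcond; apply: eq_bigr => S _.
    by rewrite inE; case: (room S) => //; case: (c @: S == setT).
  apply: (big_ind2 (fun m n => odd m = odd n)) => // [m1 m2 n1 n2|S].
    by rewrite !oddD => -> ->.
  by move=> /andP[_ /eqP cS]; rewrite odd_card_rainbow_facets ?oddb.
pose D0 := e @: [set~ i0].
have D0_door : door D0 && (#|D0|.+1 == #|I|).
  rewrite card_imset // cardsC1; apply/andP; split.
    apply/eqP; rewrite /D0 -imset_comp -[RHS]imset_id; apply: eq_imset => i.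
    by rewrite /= c_e.
  by apply/eqP/prednK/card_gt0P; exists i0.
have : odd #|[set S | room S && (c @: S == setT)]|.
  rewrite -odd_lhs sumE (bigD1 D0) //= card_outer_extension oddD /=.
  apply: (big_ind (fun m => ~~ odd m)) => // [m n /negPf mo /negPf no|D].
    by rewrite oddD mo no.
  move=> /andP[/andP[/eqP doorD /eqP cardD] DD0].
  case: (boolP (dominant D)) => [domD|ndomD]; last first.
    rewrite (_ : [set x | _] = set0) ?cards0 //; apply/setP => x.
    rewrite !inE; apply/negbTE; apply: contra ndomD => /andP[_].
    by apply: sub_dominant; apply: subsetUr.
  (* As [e j] has colour [j], a door made of slack points only is contained in [D0], and equals it
     by cardinality. *)
  have [z zD zr] : exists2 z, z \in D & z \notin codom e.
    apply/exists_inP; apply: contraNT DD0 => /exists_inPn De.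
    have sub : D \subset D0.
      apply/subsetP => x xD; have := De x xD; rewrite negbK => /codomP[j xE].
      rewrite xE; apply: imset_f; rewrite -doorD.
      by apply/imsetP; exists x; rewrite // xE c_e.
    rewrite eqEcard sub /=; case/andP: D0_door => _ /eqP.
    by rewrite -cardD => -[->].
  rewrite (@card_dominant_extensions _ z e) // => i j ij.
  exact: e_max.
case: (set_0Vmem [set S | room S && (c @: S == setT)]) => [->|[S]].
  by rewrite cards0.
by rewrite inE => /andP[/andP[dS _] /eqP cS] _; exists S.
Qed.

End Scarf.

(** * Rainbow families of points on the integer grid of the simplex *)

Definition grid (n N : nat) :=
  {x : {ffun 'I_n -> 'I_N.+1} | \sum_i x i == N :> nat}.

Lemma grid_ge (n N : nat) (y : 'I_n -> nat) (i0 : 'I_n) :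
  \sum_i y i <= N -> exists x : grid n N, forall i, y i <= val x i.
Proof.
move=> yN; pose y' i := if i == i0 then y i + (N - \sum_j y j) else y i.
have sum_y' : \sum_i y' i = N.
  rewrite (bigD1 i0) //= /y' eqxx (eq_bigr y); last by move=> i /negPf ->.
  have yE : \sum_i y i = y i0 + \sum_(i | i != i0) y i by rewrite (bigD1 i0).
  by rewrite addnAC -yE subnKC.
have y'N i : y' i < N.+1.
  by rewrite ltnS -sum_y' (bigD1 i) //= leq_addr.
pose x0 : {ffun 'I_n -> 'I_N.+1} := [ffun i => Ordinal (y'N i)].
have xP : \sum_i x0 i == N :> nat.
  by rewrite -[X in _ == X]sum_y'; apply/eqP/eq_bigr => i _; rewrite ffunE.
exists (Sub x0 xP : grid n N) => i; rewrite /= ffunE /= /y'.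
by case: ifP => // _; rewrite leq_addr.
Qed.

(** Scarf's lemma is applied to the grid together with one slack point per coordinate, of that
    colour. Dominance forces the coordinate minima of the rainbow set to sum to more than [N - n],
    which leaves its points less than [n] apart. The alternative [val z i < n] is the case where
    colour [i] may come only from its slack point. *)
Lemma rainbow_grid_points (n N : nat) (c : grid n N -> 'I_n) : 0 < n ->
  exists z : grid n N, forall i, val z i < n \/ exists x : grid n N,
    c x = i /\ forall j, val z j < val x j + n /\ val x j < val z j + n.
Proof.
move=> n_gt0; pose i0 := Ordinal n_gt0; pose T := grid n N.
pose t := #|{: T}|.
have rank_lt (x : T) : enum_rank x < t by [].
(* Grid points are ordered by coordinate [i], ties being broken by [enum_rank] as a digit in base
   [t]. The successor leaves rank 0 to the slack point [i]; the other slack points come above the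
   largest possible grid rank [N.+1 * t]. *)
pose rk (i : 'I_n) (v : 'I_n + T) := match v with
  | inl j => if j == i then 0 else N.+1 * t + j.+1
  | inr x => (val x i * t + enum_rank x).+1 end.
have rk_real i (x : T) : rk i (inr x) <= N.+1 * t.
  have xN : val x i <= N by rewrite -ltnS.
  by have := rank_lt x; rewrite /rk; nia.
have rk_inj i : injective (rk i).
  move=> [j|x] [k|y].
  - rewrite /rk; case: eqP => [->|_]; case: eqP => [->|_] //; first by lia.
      by lia.
    by move=> jk; congr inl; apply: val_inj => /=; lia.
  - have := rk_real i y; rewrite {2 3}/rk; case: eqP => _ /=; lia.
  - have := rk_real i x; rewrite {2 3}/rk; case: eqP => _ /=; lia.
  - rewrite /rk => -[xy]; congr inr; apply: enum_rank_inj; apply: val_inj => /=.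
    have := congr1 (modn^~ t) xy.
    by rewrite /= !modnMDl !modn_small.
have [y0 _] : exists y0 : T, forall i, 0 <= val y0 i.
  by apply: (@grid_ge n N (fun=> 0) i0); rewrite big1.
have realE (v : 'I_n + T) : v \notin codom inl -> exists x, v = inr x.
  by case: v => [j|x]; [rewrite codom_f|exists x].
pose c' (v : 'I_n + T) := match v with inl i => i | inr x => c x end.
have [S /dominantP dS cS] : exists2 S, dominant rk S & c' @: S = setT.
  apply: (@Scarf_lemma _ _ rk rk_inj inl) => //.
  - by move=> i y; rewrite /rk eqxx.
  - move=> i j y ij /realE[x ->]; apply: leq_ltn_trans (rk_real _ _) _.
    by rewrite /rk eq_sym (negPf ij); lia.
  - by exists (inr y0); apply/negP => /codomP[].
pose C := [set i | inl i \notin S].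
(* An order witnessing dominance over a grid point cannot have its own slack point in [S], that
   point having rank 0. *)
have dom_real (y : T) : exists2 i, i \in C &
    forall x : T, inr x \in S -> rk i (inr y) <= rk i (inr x).
  have [i Hi] := dS (inr y); exists i => [|x /Hi //].
  by rewrite inE; apply/negP => /Hi; rewrite /rk eqxx.
have [i1 i1C _] := dom_real y0.
have colC i : i \in C -> exists2 x : T, inr x \in S & c x = i.
  rewrite inE => iS; have : i \in c' @: S by rewrite cS inE.
  case/imsetP => -[j|x] vS iE; last by exists x.
  by move: iS; rewrite iE /= vS.
have [z zS _] := colC _ i1C.
pose k i : nat := val [arg min_(x < z | inr x \in S) (val x i)] i.
have k_min i (x : T) : inr x \in S -> k i <= val x i.
  by rewrite /k; case: arg_minnP => // x' _ H /H.
have k_att i : exists2 x : T, inr x \in S & k i = val x i.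
  by rewrite /k; case: arg_minnP => // x xS _; exists x.
(* Otherwise some grid point has all coordinates in [C] at least [k i + 1], so it beats a point of
   [S] in every order of [C], against [dom_real]. The summand [n] bounds the number of added
   ones. *)
have sum_k : N < \sum_(i in C) k i + n.
  have : N < \sum_(i in C) (k i).+1.
    rewrite ltnNge; apply/negP => le.
    have [|y Hy] := @grid_ge n N (fun i => if i \in C then (k i).+1 else 0) i0.
      by rewrite -big_mkcond.
    have [i iC Hi] := dom_real y; have [x xS kx] := k_att i.
    have := Hi x xS; have := Hy i; rewrite iC kx /rk.
    by have := rank_lt x; nia.
  under eq_bigr do rewrite -addn1.
  rewrite big_split /= sum1_card => /leq_trans; apply; rewrite leq_add2l.
  by rewrite -[X in _ <= X]card_ord max_card.
(* The other coordinates of [x] are at least the minima [k], and the total is [N], so little is left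
   for coordinate [j]. *)
have sumC (x : T) : inr x \in S -> forall j,
    val x j < (if j \in C then k j else 0) + n.
  move=> xS j.
  have xE : val x j + \sum_(i | i != j) val x i = N.
    by rewrite -[RHS](eqP (valP x)) [RHS](bigD1 j).
  have kE : \sum_(i in C) k i = (if j \in C then k j else 0) +
      \sum_(i | i != j) (if i \in C then k i else 0).
    by rewrite big_mkcond (bigD1 j).
  have : \sum_(i | i != j) (if i \in C then k i else 0) <=
      \sum_(i | i != j) val x i.
    by apply: leq_sum => i _; case: ifP => // _; apply: k_min.
  by move: sum_k; rewrite kE; lia.
exists z => i; case: (boolP (i \in C)) => iC; last first.
  by left; have := sumC z zS i; rewrite (negPf iC).
right; have [x xS cx] := colC i iC; exists x; split=> // j.
have := sumC z zS j; have := sumC x xS j.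
by case: ifP => _; have := k_min j x xS; have := k_min j z zS; lia.
Qed.

From mathcomp Require Import all_classical all_reals all_analysis.
Import Order.TTheory GRing.Theory Num.Theory.
Import numFieldNormedType.Exports.
Local Open Scope classical_set_scope.
Local Open Scope ring_scope.

(** * Brouwer's fixed point theorem on the simplex *)

Definition simplex (R : realType) (n : nat) : set 'rV[R]_n :=
  [set x | (forall i, 0 <= x 0 i) /\ \sum_i x 0 i = 1].

Lemma compact_simplex (R : realType) (n : nat) : compact (@simplex R n).
Proof.
apply: (@subclosed_compact _ _
  [set v : 'rV[R]_n | forall i, `[0, 1]%classic (v ord0 i)]).
- rewrite (_ : @simplex R n = (\bigcap_(i in [set: 'I_n])
      ((fun v : 'rV[R]_n => v 0 i) @^-1` [set t | 0 <= t])) `&`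
      ((fun v : 'rV[R]_n => \sum_i v 0 i) @^-1` [set 1])); last first.
    apply/seteqP; split=> x [x0 x1]; split=> // i *; exact: x0.
  apply: closedI.
    apply: closed_bigI => i _; apply: preimage_closed; last exact: closed_ge.
    by move=> x _; exact: coord_continuous.
  apply: preimage_closed; last exact: closed_eq.
  move=> x _; apply: cvg_big; [exact: add_continuous|exact: nbhs_filter|].
  by move=> i _; exact: coord_continuous.
- apply: (@rV_compact R n (fun=> `[0, 1]%classic)) => i.
  exact: segment_compact.
- move=> x [x0 x1] i; rewrite /= in_itv /= x0 -x1 (bigD1 i) //= lerDl.
  exact: sumr_ge0.
Qed.

(** The grid is fine enough that [n] steps measure less than [d]. A colour exists at each point
    because [x] and [f x] have equal coordinate sums. If [z] has its [i]-th coordinate below [n]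
    steps, [x = z] serves, since the coordinates of [f z] are nonnegative. *)
Lemma approximate_Brouwer (R : realType) (n : nat) (f : 'rV[R]_n -> 'rV[R]_n)
    (d : R) : (0 < n)%N -> 0 < d ->
    (forall x, @simplex R n x -> @simplex R n (f x)) ->
  exists z, @simplex R n z /\ forall i, exists x,
    [/\ @simplex R n x, forall j, `|x 0 j - z 0 j| < d & z 0 i <= f x 0 i + d].
Proof.
move=> n_gt0 d_gt0 fS.
have [N N_gt] : exists N, n%:R / d < N.+1%:R.
  by exists (Num.truncn (n%:R / d)); rewrite truncnS_gt.
have N_gt0 : 0 < N.+1%:R :> R by rewrite ltr0n.
have nNd : n%:R / N.+1%:R < d by rewrite ltr_pdivrMr // mulrC -ltr_pdivrMr.
pose p (x : grid n N.+1) : 'rV[R]_n := \row_i ((val x i)%:R / N.+1%:R).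
have pS x : simplex (p x).
  split=> [i|]; first by rewrite mxE divr_ge0.
  under eq_bigr do rewrite mxE.
  by rewrite -mulr_suml -natr_sum (eqP (valP x)) divff ?gt_eqF.
have close (x z : grid n N.+1) j : (val z j < val x j + n)%N ->
    p z 0 j < p x 0 j + d.
  rewrite !mxE => zx; apply: le_lt_trans (_ : _ <= (val x j)%:R / N.+1%:R +
    n%:R / N.+1%:R) _; last by rewrite ltrD2l.
  by rewrite -mulrDl -natrD ler_pM2r ?invr_gt0 // ler_nat ltnW.
have colour x : exists i, p x 0 i <= f (p x) 0 i.
  apply: contrapT => /forallNP H.
  have [_ p1] := pS x; have [_ f1] := fS _ (pS x).
  have : \sum_i f (p x) 0 i < \sum_i p x 0 i.
    apply: ltr_sum => [|i _]; last by rewrite ltNge; apply/negP/H.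
    by apply/hasP; exists (Ordinal n_gt0); rewrite ?mem_index_enum.
  by rewrite p1 f1 ltxx.
have [c cP] := choice colour.
have [z zP] := rainbow_grid_points c n_gt0.
exists (p z); split=> // i; case: (zP i) => [zi|[x [cx xz]]].
  exists (p z); split=> // [j|]; first by rewrite subrr normr0.
  have [f0 _] := fS _ (pS z).
  apply: le_trans (_ : d <= _); last by rewrite lerDr.
  rewrite mxE (le_trans _ (ltW nNd)) // ler_pM2r ?invr_gt0 // ler_nat.
  exact: ltnW.
exists (p x); split=> // [j|].
  have [zx xz'] := xz j; have := close _ _ _ zx; have := close _ _ _ xz'.
  by rewrite ltr_norml => ? ?; apply/andP; split; lra.
have [zx _] := xz i; apply: le_trans (ltW (close _ _ _ zx)) _.
by rewrite lerD2r -[i]cx.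
Qed.

Theorem Brouwer_simplex (R : realType) (n : nat) (f : 'rV[R]_n -> 'rV[R]_n) :
    (0 < n)%N -> {within @simplex R n, continuous f} ->
    (forall x, @simplex R n x -> @simplex R n (f x)) ->
  exists2 x, @simplex R n x & f x = x.
Proof.
move=> n_gt0 /subspace_continuousP fc fS.
have /choice[z zP] (k : nat) := @approximate_Brouwer R n f k.+1%:R^-1 n_gt0
  ltac:(by rewrite invr_gt0) fS.
have [x [xS xcl]] : @simplex R n `&` cluster (z @ \oo) !=set0.
  apply: (@compact_simplex R n); exists 0%N => // k _; exact: (zP k).1.
exists x => //; have [x0 x1] := xS; have [f0 f1] := fS _ xS.
(* The nonnegative differences [f x 0 i - x 0 i] sum to [1 - 1 = 0], so one-sided inequalities
   suffice. *)
suff le_xf i : x 0 i <= f x 0 i.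
  apply/rowP => i; apply/eqP; rewrite -subr_eq0; apply/eqP.
  have := @psumr_eq0P R 'I_n xpredT (fun i => f x 0 i - x 0 i).
  apply => // [j _|]; first by rewrite subr_ge0.
  by rewrite sumrB x1 f1 subrr.
apply/ler_addgt0Pr => e e_gt0.
have e3 : 0 < e / 3 by rewrite divr_gt0.
have /nbhs_ballP[d /= d_gt0 fd] :
    within (@simplex R n) (nbhs x) [set y | `|f x 0 i - f y 0 i| < e / 3].
  apply: (fc x xS [set y : 'rV[R]_n | `|f x 0 i - y 0 i| < e / 3]).
  exact: (cvgr_dist_lt _ _ (@coord_continuous R 1 n 0 i (f x)) _ e3).
(* One half of [d'] is for the distance from [x] to [z k], the other for that from [z k] to the
   point [y] coloured [i]; [y] then stays within [d] of [x]. *)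
pose d' := Num.min d (e / 3); have d'_gt0 : 0 < d' / 2.
  by rewrite divr_gt0 // lt_min d_gt0.
have [] := xcl [set z k | k in [set k | k.+1%:R^-1 < d' / 2]] (ball x (d' / 2)).
- apply: filterS (near_infty_natSinv_lt (PosNum d'_gt0)) => k /= kd.
  by exists k.
- exact: nbhsx_ballx.
move=> _ [[k /= kd <-] [_ xz]]; have [zS /(_ i)[y [yS yz zy]]] := zP k.
have d'd : d' <= d by rewrite ge_min lexx.
have d'e : d' <= e / 3 by rewrite ge_min lexx orbT.
move: (k.+1%:R^-1) kd yz zy => dk kd yz zy; clearbody d'.
have xy : ball x d y.
  split=> // a j; rewrite ord1; have := xz 0 j; have := yz j; rewrite /ball /=.
  by rewrite !ltr_norml => /andP[? ?] /andP[? ?]; apply/andP; split; lra.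
have := fd y xy yS; have := xz 0 i; rewrite /ball /=.
by rewrite !ltr_norml => /andP[? ?] /andP[? ?]; lra.
Qed.

(** * Schauder's fixed point theorem *)

Lemma cvg_rV (R : realType) (n : nat) (T : Type) (F : set_system T)
    (FF : Filter F) (f : T -> 'rV[R]_n) (v : 'rV[R]_n) :
  (forall i, f x 0 i @[x --> F] --> v 0 i) -> f @ F --> v.
Proof.
move=> fv A [P Pv PA].
have : \forall x \near F, forall i, P 0 i (f x 0 i).
  by apply: filter_forall => i; apply: fv; apply: Pv.
by apply: filterS => x Px; apply: PA => i j; rewrite ord1; apply: Px.
Qed.

Lemma cvg_within_comp (T U W : topologicalType) (A : set T) (B : set U)
    (f : T -> U) (g : U -> W) (x : T) :
    (forall y, A y -> B (f y)) ->
    f y @[y --> within A (nbhs x)] --> f x ->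
    g y @[y --> within B (nbhs (f x))] --> g (f x) ->
  g (f y) @[y --> within A (nbhs x)] --> g (f x).
Proof.
move=> fB fc gc P /gc gP.
have fP : nbhs x [set y | A y -> B (f y) -> P (g (f y))] := fc _ gP.
change (nbhs x [set y | A y -> P (g (f y))]).
by apply: filterS fP => y Py Ay; apply: Py => //; apply: fB.
Qed.

(** Induction on partial sums divided by their total weight, so that each is again a convex
    combination. A tail of weight zero vanishes and is treated apart. *)
Lemma convex_sum (R : realType) (X : normedModType R) (C : set X) (n : nat)
    (l : 'I_n -> R) (y : 'I_n -> X) :
    convex_set C -> (forall i, C (y i)) -> (forall i, 0 <= l i) ->
    \sum_i l i = 1 -> C (\sum_i l i *: y i).
Proof.
move=> cC Cy l0 l1.
have conv2 (t : R) u v : 0 <= t -> t <= 1 -> C u -> C v ->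
    C (t *: u + (1 - t) *: v).
  move=> t0 t1 /mem_set Cu /mem_set Cv; apply: set_mem.
  exact: (cC u v (Itv01 t0 t1)).
suff H (s : seq 'I_n) : 0 < \sum_(i <- s) l i ->
    C ((\sum_(i <- s) l i)^-1 *: \sum_(i <- s) l i *: y i).
  by have := H (index_enum _); rewrite l1 invr1 scale1r; apply.
elim: s => [|i s IH]; first by rewrite big_nil ltxx.
rewrite !big_cons; set a := l i; set b := \sum_(j <- s) l j.
set v := \sum_(j <- s) _ => ab.
have a0 : 0 <= a by exact: l0.
have b0 : 0 <= b by apply: sumr_ge0.
have [b_eq0|b_neq0] := eqVneq b 0.
  have -> : v = 0.
    rewrite /v big_seq big1 // => j js; suff -> : l j = 0 by rewrite scale0r.
    apply/eqP; rewrite eq_le l0 andbT -b_eq0 /b (big_rem j) //= lerDl.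
    exact: sumr_ge0.
  move: ab; rewrite b_eq0 !addr0 => a_gt0.
  by rewrite scalerA mulVf ?gt_eqF // scale1r.
have b_gt0 : 0 < b by rewrite lt_neqAle eq_sym b_neq0.
have -> : (a + b)^-1 *: (a *: y i + v) =
    ((a + b)^-1 * a) *: y i + (1 - (a + b)^-1 * a) *: (b^-1 *: v).
  rewrite scalerDr !scalerA; congr (_ + _ *: _).
  by field; rewrite b_neq0 gt_eqF.
apply: conv2 => //; last exact: IH.
- by rewrite mulr_ge0 // invr_ge0 ltW.
- by rewrite mulrC ler_pdivrMr // mul1r lerDl.
Qed.

(** Schauder projection: finitely many [e]-balls centred at points [y i] of [A] and [C] cover the
    image of [G], and a partition of unity replaces [G] by a map of the simplex spanned by the
    centres. *)
Lemma approximate_fixed_point (R : realType) (X : normedModType R)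
    (C A : set X) (G : X -> X) (e : R) :
    C !=set0 -> closed C -> convex_set C -> compact A ->
    {within C, continuous G} -> (forall x, C x -> C (G x) /\ A (G x)) ->
    0 < e -> exists2 x, C x & `|x - G x| <= e.
Proof.
move=> [c0 Cc0] clC cC cA /subspace_continuousP Gc GC e_gt0.
have : compact (A `&` C) by apply: compact_closedI.
rewrite compact_cover => /(_ _ (A `&` C) (fun x => ball x e)).
case=> [x _|x ACx|D DAC cov]; first exact: ball_open.
  by exists x => //; apply: ballxx.
pose n := size (finmap.enum_fset D).
pose y (i : 'I_n) := tnth (in_tuple (finmap.enum_fset D)) i.
have yC i : C (y i).
  by have /set_mem[] : y i \in A `&` C by apply: DAC; apply: mem_tnth.
have ycov x : C x -> exists i, `|y i - G x| < e.
  move=> Cx; have [CG AG] := GC x Cx; have [z zD zx] := cov _ (conj AG CG).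
  have /tnthP[i zE] : z \in in_tuple (finmap.enum_fset D) by [].
  by exists i; rewrite /y -zE; move: zx; rewrite /= -ball_normE.
(* Twice the positive part of [e - |y i - v|]: continuous in [v], and positive exactly on the ball
   around [y i]. *)
pose w i (v : X) : R := e - `|y i - v| + `|e - `|y i - v| |.
have w_ge0 i v : 0 <= w i v.
  by rewrite /w; move: (e - _) => a; rewrite -lerBlDl sub0r -normrN ler_norm.
have w_gt0 i v : `|y i - v| < e -> 0 < w i v.
  by move=> lt; rewrite /w ger0_norm ?subr_ge0 ?ltW // addr_gt0 ?subr_gt0.
have w_eq0 i v : e <= `|y i - v| -> w i v = 0.
  by move=> le; rewrite /w ler0_norm ?subr_le0 // subrr.
pose W v := \sum_i w i v.
have W_gt0 x : C x -> 0 < W (G x).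
  move=> /ycov[i iG]; rewrite /W (bigD1 i) //= ltr_pwDl ?w_gt0 //.
  exact: sumr_ge0.
pose p (l : 'rV[R]_n) := \sum_i l 0 i *: y i.
have pC l : simplex l -> C (p l) by case=> l0 l1; apply: convex_sum.
(* At a fixed point [l] of [f], the weight [l 0 i] vanishes unless [y i] is within [e] of [G (p l)],
   so their combination [p l] is too. *)
pose f l : 'rV[R]_n := \row_i (w i (G (p l)) / W (G (p l))).
have n_gt0 : (0 < n)%N.
  by have [i _] := ycov _ Cc0; apply: leq_trans (ltn_ord i).
have [| |l lS lf] := @Brouwer_simplex R n f n_gt0.
- apply/subspace_continuousP => l lS; apply: cvg_rV => i.
  have GpC : G (p t) @[t --> within (@simplex R n) (nbhs l)] --> G (p l).
    apply: (@cvg_within_comp _ _ _ _ C) => //; last exact/Gc/pC.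
    apply: cvg_within_filter.
    apply: cvg_big => [|j _]; first exact: add_continuous.
    by apply: cvgZl; exact: coord_continuous.
  have wc j : w j (G (p t)) @[t --> within (@simplex R n) (nbhs l)] -->
      w j (G (p l)).
    have ac : e - `|y j - G (p t)| @[t --> within (@simplex R n) (nbhs l)] -->
        e - `|y j - G (p l)|.
      apply: cvgB; first exact: cvg_cst.
      by apply: cvg_norm; apply: cvgB => //; exact: cvg_cst.
    by apply: cvgD => //; exact: cvg_norm.
  rewrite mxE; under eq_fun do rewrite mxE.
  apply: cvgM => //; apply: cvgV.
    by rewrite gt_eqF // W_gt0 //; apply: pC.
  by apply: cvg_big => //; exact: add_continuous.
- move=> l lS; have Wp := W_gt0 _ (pC _ lS); split=> [i|].
    by rewrite mxE divr_ge0 // ltW.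
  by under eq_bigr do rewrite mxE; rewrite -mulr_suml divff ?gt_eqF.
have [l0 l1] := lS; exists (p l); first exact: pC.
have -> : p l - G (p l) = \sum_i l 0 i *: (y i - G (p l)).
  rewrite -[X in _ - X]scale1r -l1 scaler_suml -sumrB.
  by apply: eq_bigr => i _; rewrite scalerBr.
apply: le_trans (ler_norm_sum _ _ _) _.
apply: le_trans (_ : \sum_i l 0 i * e <= _); last first.
  by rewrite -mulr_suml l1 mul1r.
apply: ler_sum => i _; rewrite normrZ ger0_norm //.
have [le|lt] := leP e `|y i - G (p l)|; last by rewrite ler_wpM2l // ltW.
by rewrite -lf mxE w_eq0 // !mul0r.
Qed.

(** Compactness concerns the images, so the cluster point [y] is taken of [G (x k)], where [G] moves
    [x k] by at most [1/(k+1)]. Then [x k] comes near [y] as well, and continuity at [y] gives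
    [G y = y]. *)
Theorem Schauder (R : realType) (X : normedModType R) (C A : set X)
    (G : X -> X) :
    C !=set0 -> closed C -> convex_set C -> compact A ->
    {within C, continuous G} -> (forall x, C x -> C (G x) /\ A (G x)) ->
  exists2 x, C x & G x = x.
Proof.
move=> C0 clC cC cA Gc GC.
have /choice[x xP] (k : nat) :
    exists x, C x /\ `|x - G x| <= k.+1%:R^-1.
  have k0 : 0 < k.+1%:R^-1 :> R by rewrite invr_gt0.
  by have [x] := approximate_fixed_point C0 clC cC cA Gc GC k0; exists x.
move: Gc => /subspace_continuousP Gc.
have [y [[Ay Cy] ycl]] : (A `&` C) `&` cluster (G (x k) @[k --> \oo]) !=set0.
  apply: (compact_closedI cA clC); exists 0%N => // k _.
  by have [? ?] := GC _ (xP k).1; split.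
exists y => //; apply/eqP; rewrite -subr_eq0 -normr_le0.
apply/ler_addgt0Pr => e e_gt0; rewrite add0r.
have e3 : 0 < e / 3 by rewrite divr_gt0.
have /nbhs_ballP[d /= d_gt0 Gd] :
    within C (nbhs y) [set z | `|G y - G z| < e / 3].
  exact: (cvgr_dist_lt _ _ (Gc y Cy) _ e3).
pose d' := Num.min d (e / 3); have d'_gt0 : 0 < d' / 2.
  by rewrite divr_gt0 // lt_min d_gt0.
have [] := ycl [set G (x k) | k in [set k | k.+1%:R^-1 < d' / 2]]
  (ball y (d' / 2)).
- apply: filterS (near_infty_natSinv_lt (PosNum d'_gt0)) => k /= kd.
  by exists k.
- exact: nbhsx_ballx.
rewrite -!ball_normE in Gd *.
move=> _ [[k /= kd <-] yG]; have [Cxk xGk] := xP k.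
have d'd : d' <= d by rewrite ge_min lexx.
have d'e : d' <= e / 3 by rewrite ge_min lexx orbT.
move: (k.+1%:R^-1) kd xGk => dk kd xGk; clearbody d'.
have yx : `|y - x k| < d.
  rewrite -[y - _](subrKA (G (x k))); apply: le_lt_trans (ler_normD _ _) _.
  by rewrite distrC in xGk; lra.
have := Gd _ yx Cxk; rewrite /= => GG.
rewrite -[G y - _](subrKA (G (x k))); apply: le_trans (ler_normD _ _) _.
by rewrite [`|G (x k) - _|]distrC; lra.
Qed.

(** * The fibering map *)

(** If [F] missed a neighbourhood [U] of [x], its trace on the complement of [U] would be proper and
    cluster in [V], necessarily at [x], which is absurd. *)
Lemma compact_unique_cluster (T : topologicalType) (F : set_system T)
    (FF : Filter F) (V : set T) (x : T) :
    compact V -> F V -> (forall t, V t -> cluster F t -> t = x) -> F --> x.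
Proof.
move=> cV FV clx U xU; apply: contrapT => nFU.
have PG : ProperFilter (within (~` U) F).
  split; last exact: within_filter.
  move=> F0; apply: nFU.
  apply: (@filterS _ F _ [set t | ~ U t -> False]) F0 => t; exact: contrapT.
have [t [Vt tcl]] := cV _ PG (filterS (fun t Vt _ => Vt) FV).
have tx : t = x.
  apply: clx => // A B FA tB; apply: tcl => //.
  by apply: filterS FA => z Az _.
have [z []] := tcl (~` U) U (withinT _ FF) (eq_ind_r (fun t => nbhs t U) xU tx).
by [].
Qed.

(** An implicit function argument without derivatives: near [p0] the values of [s] lie in a compact
    interval, and by continuity any cluster value is a zero of [Phi (p0, _)], hence [s p0]. *)
Lemma cvg_unique_zero (R : realType) (T : topologicalType) (D : set T)
    (Phi : T * R -> R) (s : T -> R) (p0 : T) (a b : R) :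
    D p0 -> (forall p, D p -> Phi (p, s p) = 0) ->
    (\forall p \near within D (nbhs p0), s p \in `[a, b]) ->
    (forall t, t \in `[a, b] -> Phi (p0, t) = 0 -> t = s p0) ->
    (forall t, t \in `[a, b] ->
      Phi q @[q --> within (D `*` `[a, b]%classic) (nbhs (p0, t))] -->
      Phi (p0, t)) ->
  s p @[p --> within D (nbhs p0)] --> s p0.
Proof.
move=> Dp0 Phi0 sab Phi_uniq Phic.
apply: (@compact_unique_cluster _ _ _ `[a, b]%classic) => //.
  exact: segment_compact.
move=> t tab tcl; apply: Phi_uniq => //.
apply: contrapT => /eqP Pt.
have [[A1 A2] /= [A1p A2t] A12] :
    within (D `*` `[a, b]%classic) (nbhs (p0, t)) [set q | Phi q != 0].
  exact: (cvgr_neq0 _ (Phic t tab) Pt).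
have sA : \forall p \near within D (nbhs p0), (A1 p /\ D p) /\ s p \in `[a, b].
  have A1D : \forall p \near within D (nbhs p0), A1 p /\ D p.
    by apply: (filterS _ A1p) => p A1q Dq.
  exact: filterI A1D sab.
have [] := tcl [set s p | p in [set p | (A1 p /\ D p) /\ s p \in `[a, b]]] A2.
- by apply: (filterS _ sA) => p ?; exists p.
- exact: A2t.
move=> _ [[p [[A1q Dq] sq] <-] A2s].
have := A12 (p, s p) (conj A1q A2s) (conj Dq sq).
by rewrite /= Phi0 // eqxx.
Qed.

(** * Radial projection onto a ball; closed and convex products *)

Definition radial_projection (R : realType) (X : normedModType R) (r : R)
  (w : X) : X := (r / Num.max r `|w|) *: w.

Section radial_projection.
Variables (R : realType) (X : normedModType R) (r : R).
Hypothesis r_gt0 : 0 < r.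
Implicit Type w : X.

Let max_gt0 w : 0 < Num.max r `|w|. Proof. by rewrite lt_max r_gt0. Qed.

(** The maximum with [r] keeps the denominator positive, so one formula covers the ball and its
    complement. *)
Lemma continuous_radial_projection : continuous (@radial_projection R X r).
Proof.
move=> w; apply: cvgZ; last exact: cvg_id.
apply: cvgM; first exact: cvg_cst.
apply: cvgV; first by rewrite gt_eqF.
apply: (@continuous2_cvg _ R R R _ _ (fun=> r) _ Num.max r).
- exact: (@max_continuous _ R (r, `|w|)).
- exact: cvg_cst.
- exact: norm_continuous.
Qed.

Lemma norm_radial_projection w : `|radial_projection r w| <= r.
Proof.
have r_ge0 : 0 <= r / Num.max r `|w| by rewrite divr_ge0 // ltW.
rewrite /radial_projection normrZ (ger0_norm r_ge0) mulrAC ler_pdivrMr //.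
by rewrite ler_pM2l // le_max lexx orbT.
Qed.

Lemma radial_projection_id w : `|w| <= r -> radial_projection r w = w.
Proof.
by move=> wr; rewrite /radial_projection max_l // divff ?scale1r // gt_eqF.
Qed.

Lemma radial_projection_out w : r < `|w| ->
  radial_projection r w = (r / `|w|) *: w.
Proof. by move=> rw; rewrite /radial_projection max_r // ltW. Qed.

End radial_projection.

Lemma closedX (T U : topologicalType) (A : set T) (B : set U) :
  closed A -> closed B -> closed (A `*` B).
Proof.
move=> cA cB; rewrite (_ : A `*` B = (fst @^-1` A) `&` (snd @^-1` B)) //.
by apply: closedI; apply: preimage_closed => // x _;
  [exact: cvg_fst|exact: cvg_snd].
Qed.

Lemma convex_setX (R : realType) (X Y : normedModType R)
    (A : set X) (B : set Y) :
  convex_set A -> convex_set B -> convex_set (A `*` B : set (X * Y)%type).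
Proof.
move=> cA cB x y l /set_mem[xA xB] /set_mem[yA yB]; apply/mem_set; split.
  by apply: set_mem; apply: (cA x.1 y.1 l); apply/mem_set.
by apply: set_mem; apply: (cB x.2 y.2 l); apply/mem_set.
Qed.

Lemma convex_closed_ball0 (R : realType) (X : normedModType R) (r : R) :
  0 < r -> convex_set (closed_ball (0 : X) r).
Proof.
move=> r0 x y l; rewrite closed_ballE // => /set_mem + /set_mem.
rewrite /closed_ball_ /= !sub0r !normrN => xr yr.
apply/mem_set; rewrite /= sub0r normrN.
have l0 : 0 <= l%:num by [].
have l1 : 0 <= 1 - l%:num by rewrite subr_ge0.
apply: le_trans (ler_normD _ _) _; rewrite !normrZ !ger0_norm //.
apply: le_trans (lerD (ler_wpM2l l0 xr) (ler_wpM2l l1 yr)) _.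
by rewrite -mulrDl addrC subrK mul1r.
Qed.

(** * Bounds and continuity of the fibering scale and of its truncation *)

Section fibering.
Variables (R : realType) (X1 X2 : normedModType R) (K : set X1) (B : set X2).
Variables (T1 : X1 * X2 -> X1) (F : X1 * X1 -> R) (s : X1 * X2 -> R) (m M : R).
Hypothesis K_cone : forall (l : R) x, 0 <= l -> K x -> K (l *: x).
Hypothesis T1K : forall u v, K u -> K (T1 (u, v)).
Hypothesis T1c : {within K `*` setT, continuous T1}.
Hypothesis Fc : {within K `*` K, continuous F}.
Hypothesis s_unique : forall u v, K u -> u <> 0 -> B v ->
  unique (fun t : R => 0 < t /\ F (T1 (t *: u, v), t *: u) = 0) (s (u, v)).
Hypothesis m_gt0 : 0 < m.
Hypothesis s_sphere : forall u v, K u -> `|u| = 1 -> B v ->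
  m < s (u, v) /\ s (u, v) < M.

(** By uniqueness, [s] is homogeneous of degree -1 in [u]: [s (u, v)] is the value at the normalised
    [u] divided by [|u|], so the bounds on the sphere carry over. *)
Lemma fibering_bounds u v : K u -> u <> 0 -> B v ->
  m / `|u| < s (u, v) /\ s (u, v) < M / `|u|.
Proof.
move=> Ku /eqP u0 Bv; have nu : 0 < `|u| by rewrite normr_gt0.
pose u1 := `|u|^-1 *: u.
have Ku1 : K u1 by apply: K_cone; rewrite ?invr_ge0 // ltW.
have u11 : `|u1| = 1 by rewrite normrZ normfV normr_id mulVf // gt_eqF.
have u10 : u1 <> 0 by move=> u10; move: u11; rewrite u10 normr0; lra.
have [[t0 tF] _] := s_unique Ku1 u10 Bv.
have [_ /(_ (s (u1, v) / `|u|)) sE] := s_unique Ku (elimN eqP u0) Bv.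
rewrite sE; last first.
  by split; [rewrite divr_gt0|rewrite -!scalerA].
have [ms sM] := s_sphere Ku1 u11 Bv.
by rewrite !ltr_pM2r ?invr_gt0.
Qed.

Lemma cvg_fibering_map (p : X1 * X2) (t : R) : K p.1 -> 0 <= t ->
  F (T1 (q.2 *: q.1.1, q.1.2), q.2 *: q.1.1)
    @[q --> within [set q | K q.1.1 /\ 0 <= q.2] (nbhs (p, t))] -->
  F (T1 (t *: p.1, p.2), t *: p.1).
Proof.
move=> Kp t0; set E := [set q | _].
have c1 : q.2 *: q.1.1 @[q --> within E (nbhs (p, t))] --> t *: p.1.
  apply: cvg_within_filter; apply: cvgZ; first exact: cvg_snd.
  exact: (cvg_comp _ _ (cvg_fst (F := nbhs p) (G := nbhs t)) cvg_fst).
have c2 : q.1.2 @[q --> within E (nbhs (p, t))] --> p.2.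
  apply: cvg_within_filter.
  exact: (cvg_comp _ _ (cvg_fst (F := nbhs p) (G := nbhs t)) cvg_snd).
have KE (q : (X1 * X2) * R) : E q -> K (q.2 *: q.1.1).
  by case=> ? ?; apply: K_cone.
have EK : K (t *: p.1) by apply: K_cone.
move: T1c Fc => /subspace_continuousP T1c' /subspace_continuousP Fc'.
have c3 : T1 (q.2 *: q.1.1, q.1.2) @[q --> within E (nbhs (p, t))] -->
    T1 (t *: p.1, p.2).
  apply: (@cvg_within_comp _ _ _ E (K `*` setT)
    (fun q : (X1 * X2) * R => (q.2 *: q.1.1, q.1.2)) T1 (p, t)).
  - by move=> q Eq; split=> //; apply: KE.
  - exact: cvg_pair c1 c2.
  - exact: T1c'.
apply: (@cvg_within_comp _ _ _ E (K `*` K)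
  (fun q : (X1 * X2) * R => (T1 (q.2 *: q.1.1, q.1.2), q.2 *: q.1.1)) F (p, t)).
- by move=> q Eq; split; [apply: T1K|]; apply: KE.
- exact: cvg_pair c3 c1.
- by apply: Fc'; split; [apply: T1K|].
Qed.

Lemma cvg_fibering p : K p.1 -> p.1 <> 0 -> B p.2 ->
  s q @[q --> within [set q | [/\ K q.1, q.1 <> 0 & B q.2]] (nbhs p)] --> s p.
Proof.
case: p => u v /= Ku /eqP u0 Bv; have nu : 0 < `|u| by rewrite normr_gt0.
set D := [set q | _].
pose Phi (q : (X1 * X2) * R) := F (T1 (q.2 *: q.1.1, q.1.2), q.2 *: q.1.1).
have a_gt0 : 0 < m / (2 * `|u|) by rewrite divr_gt0 // mulr_gt0.
(* The interval comes from [fibering_bounds] at nearby points, whose norms lie between [|u| / 2] and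
   [2 |u|]. *)
apply: (@cvg_unique_zero R _ D Phi s _ (m / (2 * `|u|)) (2 * M / `|u|)).
- by split=> //; apply/eqP.
- by case=> u' v' [/= Ku' u0' Bv']; have [[]] := s_unique Ku' u0' Bv'.
- have : \forall q \near within D (nbhs (u, v)),
      `|u| / 2 < `|q.1| /\ `|q.1| < 2 * `|u|.
    have nc : `|q.1| @[q --> within D (nbhs (u, v))] --> `|u|.
      by apply: cvg_within_filter; apply: cvg_norm; exact: cvg_fst.
    apply: filterI.
      by apply: (cvgr_gt _ nc); rewrite ltr_pdivrMr // ltr_pMr // ltr1n.
    by apply: (cvgr_lt _ nc); rewrite ltr_pMl // ltr1n.
  move=> near_u; have nearD := withinT D (nbhs_filter (u, v)).
  apply: (filterS _ (filterI near_u nearD)).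
  move=> [u' v'] [/= [lt1 lt2] [/= Ku' u0' Bv']].
  have [sm sM] := fibering_bounds Ku' u0' Bv'.
  have nu' : 0 < `|u'| by apply: le_lt_trans lt1; rewrite divr_ge0 // ltW.
  have M_gt0 : 0 < M.
    by have := lt_trans sm sM; rewrite ltr_pM2r ?invr_gt0 //; exact: lt_trans.
  rewrite in_itv /=; apply/andP; split.
    apply: ltW; apply: le_lt_trans sm; rewrite ler_pM2l //.
    by rewrite lef_pV2 ?posrE ?mulr_gt0 // ltW.
  apply: ltW; apply: lt_le_trans sM _.
  have -> : 2 * M / `|u| = M / (`|u| / 2) by field; rewrite gt_eqF.
  by rewrite ler_pM2l // lef_pV2 ?posrE ?divr_gt0 // ltW.
- move=> t; rewrite in_itv /= => /andP[ta _] Pt.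
  have [_ su] := s_unique Ku (elimN eqP u0) Bv.
  by rewrite (su t) //; split=> //; apply: lt_le_trans ta.
- move=> t; rewrite in_itv /= => /andP[ta _].
  have t_ge0 := le_trans (ltW a_gt0) ta.
  apply: cvg_trans (cvg_fibering_map (p := (u, v)) Ku t_ge0).
  apply: cvg_app; apply: within_subset => -[q t'] [[/= Kq _ _]].
  rewrite /= in_itv /= => /andP[t'a _]; split=> //.
  by apply: le_trans t'a; exact: ltW.
Qed.

(** The scalar factor of the retraction [rho]. At [u = 0], where [s] is unconstrained, 1 is the
    continuous value, since [s] exceeds [m / |u|]. *)
Definition fiber_truncation (p : X1 * X2) : R :=
  if p.1 == 0 then 1 else Num.min 1 (s p).

Lemma fiber_truncation_ge0 p : K p.1 -> B p.2 -> 0 <= fiber_truncation p.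
Proof.
case: p => u v /= Ku Bv; rewrite /fiber_truncation; case: eqP => //= u0.
by have [[t0 _] _] := s_unique Ku u0 Bv; rewrite le_min ler01 ltW.
Qed.

(** The truncated point has norm at most [s |u| < M] when [u] is nonzero. This bounds the retracted
    region although the cone is unbounded. *)
Lemma norm_fiber_truncation p : 0 < M -> K p.1 -> B p.2 ->
  `|fiber_truncation p *: p.1| <= M.
Proof.
case: p => u v M_gt0 /= Ku Bv.
rewrite normrZ ger0_norm; last exact: fiber_truncation_ge0.
rewrite /fiber_truncation; case: eqP => /= [->|u0].
  by rewrite normr0 mulr0 ltW.
have [_ sM] := fibering_bounds Ku u0 Bv.
have nu : 0 < `|u| by rewrite normr_gt0; apply/eqP.
rewrite -ler_pdivlMr // ge_min; apply/orP; right; exact: ltW.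
Qed.

(** At [u = 0] the truncation is constantly 1 nearby, as [|u| < m] forces [s > 1]. Elsewhere it is
    locally [min 1 s], continuous by [cvg_fibering]. *)
Lemma cvg_fiber_truncation p : K p.1 -> B p.2 ->
  fiber_truncation q @[q --> within (K `*` B) (nbhs p)] --> fiber_truncation p.
Proof.
case: p => u v /= Ku Bv; have [u0|/eqP u0] := eqVneq u 0.
  rewrite {2}/fiber_truncation /= u0 eqxx; apply: cvg_near_cst.
  have : \forall q \near within (K `*` B) (nbhs (0, v)), `|q.1| < m.
    apply: (cvgr_lt (`|0 : X1|)); last by rewrite normr0.
    by apply: cvg_within_filter; apply: cvg_norm; exact: cvg_fst.
  move=> near0; have nearKB := withinT (K `*` B) (nbhs_filter (0 : X1, v)).
  apply: (filterS _ (filterI near0 nearKB)).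
  move=> [u' v'] [/= um [/= Ku' Bv']]; rewrite /fiber_truncation.
  case: eqP => //= u0'; apply: min_l; apply: ltW.
  have [sm _] := fibering_bounds Ku' u0' Bv'; apply: lt_trans sm.
  by rewrite ltr_pdivlMr ?mul1r // normr_gt0; apply/eqP.
have near_neq : \forall q \near nbhs (u, v), q.1 != 0.
  by apply: (cvgr_neq0 u); [exact: cvg_fst|apply/eqP].
have sc : s q @[q --> within (K `*` B) (nbhs (u, v))] --> s (u, v).
  apply: cvg_trans (cvg_fibering (p := (u, v)) Ku u0 Bv); apply: cvg_app => P.
  move=> nP; apply: (filterS _ (filterI near_neq nP)) => q [/eqP q0 Pq] [Kq Bq].
  exact: Pq.
rewrite {2}/fiber_truncation /= (introF eqP u0).
have mc : Num.min 1 (s q) @[q --> within (K `*` B) (nbhs (u, v))] -->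
    Num.min 1 (s (u, v)).
  apply: (@continuous2_cvg _ R R R _ _ (fun=> 1) _ Num.min 1) => //.
  - exact: (@min_continuous _ R (1, s (u, v))).
  - exact: cvg_cst.
apply: cvg_trans mc; apply: near_eq_cvg.
apply: (filterS _ near_neq) => q q0 _.
by rewrite /fiber_truncation (negPf q0).
Qed.

End fibering.

(** * The truncated operator on the cone times the ball, and its fixed point *)

Theorem theorem2p9 (R : realType) (X1 X2 : completeNormedModType R)
    (K1 : set X1) (hK1 : nondegenerate_cone K1)
    (r : R) (r_gt0 : 0 < r)
    (T1 : X1 * X2 -> X1) (T2 : X1 * X2 -> X2) (F : X1 * X1 -> R)
    (T1K1 : forall (u : X1) (v : X2), K1 u -> K1 (T1 (u, v)))
    (T1cc : completely_continuous (K1 `*` setT) T1)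
    (T2cc : completely_continuous (K1 `*` closed_ball (0 : X2) r) T2)
    (Fcont : {within K1 `*` K1, continuous F})
    (F0 : forall (u : X1) (l : R), K1 u -> u <> 0 -> 0 < l ->
      (F (l *: u, u) = 0 <-> l = 1))
    (a1 : bounded_set (T2 @` (K1 `*` closed_ball (0 : X2) r)))
    (s : X1 * X2 -> R)
    (a2 : forall (u : X1) (v : X2),
      K1 u -> u <> 0 -> closed_ball (0 : X2) r v ->
      unique (fun t : R => 0 < t /\ F (T1 (t *: u, v), t *: u) = 0) (s (u, v)))
    (a3 : exists m M : R, [/\ 0 < m, m < M,
      (m%:E < ereal_inf [set (s p)%:E
        | p in unit_sphere_in K1 `*` closed_ball (0%R : X2) r])%E &
      (ereal_sup [set (s p)%:E
        | p in unit_sphere_in K1 `*` closed_ball (0%R : X2) r] < M%:E)%E])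
    (hLS : forall (u : X1) (v : X2) (l : R),
      K1 u -> `|v| = r -> 0 < l -> l < 1 ->
      v <> l *: T2 (u, v)) :
  exists (u : X1) (v : X2),
    [/\ K1 u, closed_ball (0 : X2) r v, T1 (u, v) = u & T2 (u, v) = v].
Proof.
move: T2cc a1 a2 a3; set B := closed_ball (0 : X2) r => T2cc _ a2 a3.
have [K_closed K_convex K_cone [u0 [Ku0 _]]] := hK1.
have [m [M [m_gt0 mM m_inf sup_M]]] := a3.
have M_gt0 : 0 < M := lt_trans m_gt0 mM.
have [T1c T1comp] := T1cc; have [T2c T2comp] := T2cc.
have BE v : B v = (`|v| <= r) :> Prop.
  by rewrite /B closed_ballE // /closed_ball_ /= sub0r normrN.
have s_sphere u v : K1 u -> `|u| = 1 -> B v -> m < s (u, v) /\ s (u, v) < M.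
  move=> Ku u1 Bv; split; rewrite -lte_fin.
    by apply: lt_le_trans m_inf _; apply: ereal_inf_lbound; exists (u, v).
  by apply: le_lt_trans sup_M; apply: ereal_sup_ubound; exists (u, v).
have trunc_ge0 := @fiber_truncation_ge0 R X1 X2 K1 B T1 F s a2.
have trunc_le :=
  @norm_fiber_truncation R X1 X2 K1 B T1 F s m M K_cone a2 s_sphere.
have trunc_cvg := @cvg_fiber_truncation R X1 X2 K1 B T1 F s m M K_cone T1K1 T1c
  Fcont a2 m_gt0 s_sphere.
pose rho p := fiber_truncation s p *: p.1.
pose S (p : X1 * X2) := (rho p, p.2).
have rhoK p : K1 p.1 -> B p.2 -> K1 (rho p).
  by move=> Kp Bp; apply: K_cone => //; apply: trunc_ge0.
have rhoM p : K1 p.1 -> B p.2 -> `|rho p| <= M by apply: trunc_le.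
have Sc p : K1 p.1 -> B p.2 -> S q @[q --> within (K1 `*` B) (nbhs p)] --> S p.
  move=> Kp Bp; apply: cvg_pair; last first.
    by apply: cvg_within_filter; exact: cvg_snd.
  apply: cvgZ; last by apply: cvg_within_filter; exact: cvg_fst.
  exact: trunc_cvg.
(* A bounded set containing the range of [S]: complete continuity makes the images of [Q]
   precompact, and they provide the compact set [A]. *)
pose Q := [set p : X1 * X2 | [/\ K1 p.1, `|p.1| <= M & B p.2]].
have Q_bounded : bounded_set Q.
  exists (Num.max M r); split; first exact: num_real.
  move=> N; rewrite gt_max => /andP[MN rN] [u v] [/= _ uM]; rewrite BE => vr.
  by rewrite prod_normE /= ge_max !ltW //; apply: le_lt_trans; eassumption.
have SQ p : K1 p.1 -> B p.2 -> Q (S p).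
  by move=> Kp Bp; split; [apply: rhoK|apply: rhoM|].
pose pi := @radial_projection R X2 r.
pose G p := (T1 (S p), pi (T2 (S p))).
pose A := closure (T1 @` Q) `*` (pi @` closure (T2 @` Q)).
have A_compact : compact A.
  apply: compact_setX.
    by rewrite -precompactE; apply: T1comp => // p [].
  apply: continuous_compact.
    apply: continuous_subspaceT; exact: continuous_radial_projection.
  by rewrite -precompactE; apply: T2comp => // p [].
have [||||||[u v] [/= Ku Bv] [Gu Gv]] :=
  @Schauder R (X1 * X2)%type (K1 `*` B) A G.
- by exists (u0, 0); split=> //=; rewrite BE normr0 ltW.
- by apply: closedX => //; exact: closed_ball_closed.
- by apply: convex_setX => //; exact: convex_closed_ball0.
- exact: A_compact.
- move: T1c T2c => /subspace_continuousP T1c' /subspace_continuousP T2c'.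
  apply/subspace_continuousP => p [Kp Bp]; apply: cvg_pair.
    apply: (@cvg_within_comp _ _ _ _ (K1 `*` setT) S T1); last 1 first.
    - by apply: T1c'; split=> //; apply: rhoK.
    - by move=> q [Kq Bq]; split=> //; apply: rhoK.
    - exact: Sc.
  suff T2S : T2 (S q) @[q --> within (K1 `*` B) (nbhs p)] --> T2 (S p).
    apply: (cvg_comp _ _ T2S).
    exact: (@continuous_radial_projection R X2 r r_gt0 (T2 (S p))).
  apply: (@cvg_within_comp _ _ _ _ (K1 `*` B) S T2); last 1 first.
  - by apply: T2c'; split=> //; apply: rhoK.
  - by move=> q [Kq Bq]; split=> //; apply: rhoK.
  - exact: Sc.
- move=> p [Kp Bp]; have QSp := SQ p Kp Bp; split; split => /=.
  + by apply: T1K1; apply: rhoK.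
  + by rewrite BE; apply: norm_radial_projection.
  + by apply: subset_closure; exists (S p).
  + by exists (T2 (S p)) => //; apply: subset_closure; exists (S p).
have Krho := rhoK (u, v) Ku Bv.
(* If the projection were active, [v] would have norm [r] and equal [r / |T2 (S (u, v))| < 1] times
   [T2 (rho (u, v), v)]. This contradicts [hLS] taken at the cone point [rho (u, v)] rather than at
   [u]. *)
have T2v : T2 (S (u, v)) = v.
  have [le|lt] := leP `|T2 (S (u, v))| r.
    by rewrite -[RHS]Gv /pi radial_projection_id.
  have w_gt0 := lt_trans r_gt0 lt; have vE := Gv.
  rewrite /pi radial_projection_out // in vE.
  case: (hLS _ v (r / `|T2 (S (u, v))|) Krho) => //.
  - by rewrite -vE normrZ normf_div normr_id gtr0_norm // divfK ?gt_eqF.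
  - exact: divr_gt0.
  - by rewrite ltr_pdivrMr // mul1r.
suff rhoE : rho (u, v) = u.
  exists u, v; split=> //; first by rewrite -[RHS]Gu /S rhoE.
  by rewrite -[RHS]T2v /S rhoE.
rewrite /rho /fiber_truncation /=; case: eqP => [|/[dup] u_neq0 /eqP u_neq0'].
  by rewrite scale1r.
have [[s_gt0 sF] _] := a2 u v Ku u_neq0 Bv.
have [le1|lt1] := leP 1 (s (u, v)); first by rewrite scale1r.
have rhoE : rho (u, v) = s (u, v) *: u.
  by rewrite /rho /fiber_truncation /= (negPf u_neq0') min_r // ltW.
have su_neq0 : s (u, v) *: u <> 0.
  by apply/eqP; rewrite scaler_eq0 negb_or u_neq0' gt_eqF.
have T1u : T1 (s (u, v) *: u, v) = u by rewrite -[RHS]Gu /S rhoE.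
rewrite T1u in sF.
have sV_gt0 : 0 < (s (u, v))^-1 by rewrite invr_gt0.
(* The hypothesis on [F] is used at the base point [s u] with factor [1/s], for which
   [(1/s) (s u) = u]. *)
have [+ _] := F0 _ _ (K_cone _ _ (ltW s_gt0) Ku) su_neq0 sV_gt0.
rewrite scalerA mulVf ?gt_eqF // scale1r => /(_ sF) s1.
by move: lt1; rewrite -[s _]invrK s1 invr1 ltxx.
Qed.
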